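(* Let $\mathcal{D}=\{x_1,\dots,x_N\}\subseteq X$, a query $q\in X$ and an integer $K\ge1$ be given, and let $y_m(q)=\sum_{i=1}^N c_{m,i}\,s_i(q)$, $m=1,\dots,M$, be $M$ linear measurements with all $c_{m,i}\in[-1,1]$, where $s_i(q)=p(x_i,q)^K$. For any $\epsilon>0$ and $\delta\in(0,1)$, using a total of $O\!\left(M\frac{\|\tilde{\mathbf{s}}(q)\|_1^2}{\epsilon^2}\log\frac{M}{\delta}\right)$ independent ACE repetitions (divided among the $M$ measurements, each measurement estimated by the median-of-means $\hat y_m(q)$ of its own repetitions), with probability at least $1-\delta$ we have for all $m=1,\dots,M$: $$y_m(q)-\epsilon\le\hat y_m(q)\le y_m(q)+\epsilon.$$
   Context: An LSH family on $X$ is a distribution over functions $l:X\to\{1,\dots,r\}$ with collision probability $p(x,q)=\Pr_l[l(x)=l(q)]$. For integer $K\ge1$, $L=(l_1,\dots,l_K)$ with $l_j$ drawn independently. An ACE repetition for measurement $m$: draw $L$ independently, form the array $A[j]=\sum_i c_{m,i}\mathbf{1}\{L(x_i)=j\}$ and output $A[L(q)]$. $\tilde{\mathbf{s}}(q)$ has entries $\sqrt{p(x_i,q)^K}$. Median-of-means: split the repetitions into groups, average within groups, take the median.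
   Formalization: The number of repetitions is bounded by O(M·max(1, ‖s̃(q)‖₁²/ε²)·log max(2, M/δ)); without these two lower truncations the printed bound can fall below one repetition (ε much larger than ‖s̃(q)‖₁, or M=1 and δ near 1) and the claim fails. *)

(* Defs.v *)
From HB Require Import structures.
From mathcomp Require Import all_boot all_order all_algebra.
From mathcomp Require Import all_classical all_reals all_analysis.
Set Implicit Arguments.
Unset Strict Implicit.
Unset Printing Implicit Defensive.
Import Order.TTheory GRing.Theory Num.Theory.
Local Open Scope classical_set_scope.
Local Open Scope ring_scope.

HB.instance Definition _ (r : nat) := isPointed.Build 'I_r.+1 ord0.

(* Functions X -> {0, ..., r} carry the product sigma-algebra, i.e. the one
   generated by the evaluations l |-> l x.  The range is 'I_r.+1 because a
   measurableType is pointed; an empty range would only be possible for an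
   empty X. *)
Definition hash_cylinders (X : Type) (r : nat) : set (set (X -> 'I_r.+1)) :=
  [set C | exists x j, C = [set l | l x = j]].

Definition hash_function (X : Type) (r : nat) :=
  g_sigma_algebraType (@hash_cylinders X r).

Definition lsh_family (X : Type) (r : nat) (R : realType) :=
  probability (hash_function X r) R.

Definition collision_prob (X : Type) (r : nat) (R : realType)
    (F : lsh_family X r R) (x q : X) : R :=
  fine (F [set l : hash_function X r | l x = l q]).

Definition kernel_vec (X : Type) (r : nat) (R : realType)
    (F : lsh_family X r R) (K N : nat) (x : 'I_N -> X) (q : X) : 'rV[R]_N :=
  \row_i collision_prob F (x i) q ^+ K.

Definition sqrt_kernel_vec (X : Type) (r : nat) (R : realType)
    (F : lsh_family X r R) (K N : nat) (x : 'I_N -> X) (q : X) : 'rV[R]_N :=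
  \row_i Num.sqrt (collision_prob F (x i) q ^+ K).

Definition l1norm (R : realType) (N : nat) (v : 'rV[R]_N) : R :=
  \sum_i `|v 0 i|.

Definition measurement (R : realType) (N : nat) (c : 'I_N -> R)
    (s : 'rV[R]_N) : R :=
  \sum_i c i * s 0 i.

(* Mutual independence of random elements: the product rule over every subfamily of the finite index set. *)
Definition mutually_independent d d' (Omega : measurableType d)
    (T : measurableType d') (R : realType) (P : probability Omega R)
    (I : finType) (Z : I -> {RV P >-> T}) : Prop :=
  forall (J : {set I}) (A : I -> set T), (forall i, measurable (A i)) ->
    P [set w | forall i, i \in J -> A i (Z i w)]
    = (\prod_(i in J) P (Z i @^-1` A i))%E.

Definition has_law d d' (Omega : measurableType d) (T : measurableType d')
    (R : realType) (P : probability Omega R) (Z : {RV P >-> T})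
    (F : probability T R) : Prop :=
  forall A : set T, measurable A -> distribution P Z A = F A.

Definition concat_hash (X : Type) (r K : nat) (l : 'I_K -> X -> 'I_r.+1)
    (z : X) : {ffun 'I_K -> 'I_r.+1} :=
  [ffun k => l k z].

Definition ace_array (X : Type) (r K N : nat) (R : realType) (c : 'I_N -> R)
    (x : 'I_N -> X) (l : 'I_K -> X -> 'I_r.+1)
    (j : {ffun 'I_K -> 'I_r.+1}) : R :=
  \sum_i c i * (concat_hash l (x i) == j)%:R.

Definition ace_output (X : Type) (r K N : nat) (R : realType) (c : 'I_N -> R)
    (x : 'I_N -> X) (q : X) (l : 'I_K -> X -> 'I_r.+1) : R :=
  ace_array c x l (concat_hash l q).

(* The middle value, or the average of the two middle values when the length
   is even. *)
Definition median (R : realType) (s : seq R) : R :=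
  let t := sort <=%R s in
  (t`_((size s).-1)./2 + t`_((size s)./2)) / 2.

Definition median_of_means (R : realType) (g b : nat) (a : 'I_g -> 'I_b -> R)
    : R :=
  median [seq (\sum_(v < b) a u v) / b%:R | u <- enum 'I_g].

(* The order of the number of repetitions.  It equals
   M * (S ^ 2 / eps ^ 2) * log (M / delta) as soon as eps <= S and
   2 <= M / delta.  The two truncations from below account for the number
   of groups and their size being positive integers: a single repetition need not be
   eps-accurate however small S / eps or log (1 / delta) is. *)
Definition repetition_order (R : realType) (M : nat) (S eps delta : R) : R :=
  M%:R * Num.max 1 (S ^+ 2 / eps ^+ 2) * ln (Num.max 2 (M%:R / delta)).

(* Main.v *)
(* An ACE output depends on a hash function [l] only through the bits
   [l (x i) = l q], which take finitely many values; by independence the joint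
   law of all these bits is a product law on a finite set, where everything is
   a finite sum.  The mean of one repetition is [y m], and since
   [P (A `&` B) <= sqrt (P A * P B)] its second moment is at most
   [S = l1norm (sqrt_kernel_vec F K x q)] squared.  Averaging
   [b >= 16 (S / eps) ^ 2] repetitions gives, by Chebyshev's inequality, a group
   that is off by more than [eps] with probability at most [1 / 16].  The median
   is off only if at least half of the [g] groups are, which by a Chernoff bound
   has probability at most [2 ^ - g <= delta / M]; a union bound over the
   measurements concludes. *)
Require Import Defs.
From HB Require Import structures.
From mathcomp Require Import all_boot all_order all_algebra.
From mathcomp Require Import all_classical all_reals all_analysis.
From mathcomp Require Import ring lra zify.
Set Implicit Arguments.
Unset Strict Implicit.
Unset Printing Implicit Defensive.
Import Order.TTheory GRing.Theory Num.Theory.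
Local Open Scope classical_set_scope.
Local Open Scope ring_scope.

(** * Finite probability spaces and their powers *)

Definition is_fpmf (R : realType) (T : finType) (p : T -> R) :=
  (forall t, 0 <= p t) /\ \sum_t p t = 1.

Definition fmean (R : realType) (T : finType) (p h : T -> R) : R :=
  \sum_t p t * h t.

Definition fprob (R : realType) (T : finType) (p : T -> R) (A : pred T) : R :=
  fmean p (fun t => (A t)%:R).

(** Weight of the product law on [{ffun I -> T}]. This type is again finite, so [iid] can be
    iterated: bits, hash functions, repetitions, groups, measurements. *)
Definition iid (R : realType) (T : finType) (p : T -> R) {I : finType}
    (f : {ffun I -> T}) : R :=
  \prod_i p (f i).

Lemma fmeanD (R : realType) (T : finType) (p h1 h2 : T -> R) :
  fmean p (fun t => h1 t + h2 t) = fmean p h1 + fmean p h2.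
Proof. by rewrite -big_split; apply: eq_bigr => t _; rewrite mulrDr. Qed.

Lemma fmeanZ (R : realType) (T : finType) (p h : T -> R) (a : R) :
  fmean p (fun t => a * h t) = a * fmean p h.
Proof. by rewrite /fmean mulr_sumr; apply: eq_bigr => t _; rewrite mulrCA. Qed.

Lemma fmean_sum (R : realType) (T J : finType) (p : T -> R) (h : J -> T -> R) :
  fmean p (fun t => \sum_j h j t) = \sum_j fmean p (h j).
Proof.
by rewrite exchange_big; apply: eq_bigr => t _; rewrite mulr_sumr.
Qed.

Lemma fmean_cst (R : realType) (T : finType) (p : T -> R) (a : R) :
  is_fpmf p -> fmean p (fun=> a) = a.
Proof. by case=> _ p1; rewrite /fmean -mulr_suml p1 mul1r. Qed.

Lemma fmean_le (R : realType) (T : finType) (p h1 h2 : T -> R) :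
  is_fpmf p -> (forall t, h1 t <= h2 t) -> fmean p h1 <= fmean p h2.
Proof. by case=> p0 _ h12; apply: ler_sum => t _; rewrite ler_wpM2l. Qed.

Lemma eq_fmean (R : realType) (T : finType) (p h1 h2 : T -> R) :
  h1 =1 h2 -> fmean p h1 = fmean p h2.
Proof. by move=> h12; apply: eq_bigr => t _; rewrite h12. Qed.

(** Independence in product form is distributivity of a product over sums; all later facts about
    [iid] rest on it. *)
Lemma fmean_iid_prod (R : realType) (T I : finType) (p : T -> R)
    (h : I -> T -> R) :
  fmean (@iid R T p I) (fun f => \prod_i h i (f i)) = \prod_i fmean p (h i).
Proof.
rewrite /fmean bigA_distr_bigA; apply: eq_bigr => f _.
by rewrite /iid -big_split.
Qed.

Lemma fprob_compl (R : realType) (T : finType) (p : T -> R) (A : pred T) :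
  is_fpmf p -> fprob p A = 1 - fprob p (predC A).
Proof.
move=> pp; apply/eqP; rewrite eq_sym subr_eq eq_sym -fmeanD; apply/eqP.
rewrite -[RHS](fmean_cst 1 pp); apply: eq_fmean => t /=.
by case: (A t); rewrite ?addr0 ?add0r.
Qed.

Lemma iid_fpmf (R : realType) (T I : finType) (p : T -> R) :
  is_fpmf p -> is_fpmf (@iid R T p I).
Proof.
case=> p0 p1; split=> [f|]; first exact: prodr_ge0.
by rewrite /iid -(bigA_distr_bigA (fun=> p)) big1.
Qed.

Lemma fmean_iid_coord (R : realType) (T I : finType) (p h : T -> R) (i : I) :
  is_fpmf p -> fmean (@iid R T p I) (fun f => h (f i)) = fmean p h.
Proof.
(* Padding by the constant 1 at the other coordinates turns [h (f i)] into a product over all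
   coordinates. *)
move=> pp; pose k j t := if j == i then h t else 1.
rewrite (@eq_fmean _ _ _ _
    (fun f : {ffun I -> T} => \prod_j k j (f j))); last first.
  move=> f; rewrite (bigD1 i)//= /k eqxx big1 ?mulr1// => j /negPf -> //.
rewrite fmean_iid_prod (bigD1 i)//= [X in _ * X]big1 ?mulr1.
  by apply: eq_fmean => t; rewrite /k eqxx.
move=> j /negPf ji; rewrite -[RHS](fmean_cst 1 pp).
by apply: eq_fmean => t; rewrite /k ji.
Qed.

Lemma fmean_iid_coord2 (R : realType) (T I : finType) (p h1 h2 : T -> R)
    (i j : I) : is_fpmf p -> i != j ->
  fmean (@iid R T p I) (fun f => h1 (f i) * h2 (f j))
  = fmean p h1 * fmean p h2.
Proof.
move=> pp ij; pose k l t := if l == i then h1 t else if l == j then h2 t else 1.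
have ji : j != i by rewrite eq_sym.
rewrite (@eq_fmean _ _ _ _
    (fun f : {ffun I -> T} => \prod_l k l (f l))); last first.
  move=> f; rewrite (bigD1 i)//= (bigD1 j)//= /k !eqxx (negPf ji) big1 ?mulr1//.
  by move=> l /andP[/negPf -> /negPf ->].
rewrite fmean_iid_prod (bigD1 i)//= (bigD1 j)//= [X in _ * (_ * X)]big1 ?mulr1.
  by congr (_ * _); apply: eq_fmean => t; rewrite /k ?(negPf ji) eqxx.
move=> l /andP[/negPf li /negPf lj]; rewrite -[RHS](fmean_cst 1 pp).
by apply: eq_fmean => t; rewrite /k li lj.
Qed.

(** * Concentration of averages and of their median *)

(** In the expanded square, the cross terms are products of two zero means and vanish; the diagonal
    terms are all equal. *)
Lemma fmean_sqr_sum_centered (R : realType) (T I : finType) (p h : T -> R) :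
  is_fpmf p -> fmean p h = 0 ->
  fmean (@iid R T p I) (fun f => (\sum_i h (f i)) ^+ 2)
  = #|I|%:R * fmean p (fun t => h t ^+ 2).
Proof.
move=> pp h0.
rewrite (@eq_fmean _ _ _ _
    (fun f : {ffun I -> T} => \sum_i \sum_j h (f i) * h (f j))); last first.
  move=> f; rewrite expr2 mulr_suml.
  by apply: eq_bigr => i _; rewrite mulr_sumr.
rewrite fmean_sum mulr_natl -sumr_const; apply: eq_bigr => i _.
rewrite fmean_sum (bigD1 i)//= big1 ?addr0 => [|j ji].
  by rewrite (fmean_iid_coord (fun t => h t * h t) i pp).
by rewrite fmean_iid_coord2 1?eq_sym// h0 mul0r.
Qed.

Lemma chebyshev_iid_average (R : realType) (T : finType) (p W : T -> R)
    (b : nat) (s eps : R) :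
  is_fpmf p -> (0 < b)%N -> 0 < eps -> fmean p (fun t => W t ^+ 2) <= s ->
  fprob (@iid R T p 'I_b)
    (fun f => eps < `|(\sum_v W (f v)) / b%:R - fmean p W|)
  <= s / (b%:R * eps ^+ 2).
Proof.
move=> pp b0 e0 Ws; set y := fmean p W.
have b0' : 0 < b%:R :> R by rewrite ltr0n.
pose h t := W t + - y.
have h0 : fmean p h = 0 by rewrite fmeanD fmean_cst// subrr.
(* The variance is the second moment minus [y ^+ 2], so a bound on the second moment suffices. *)
have h2 : fmean p (fun t => h t ^+ 2) <= s.
  apply: le_trans Ws.
  rewrite (@eq_fmean _ _ _ _ (fun t => W t ^+ 2 + (- (2 * y) * W t + y ^+ 2)));
    last by move=> t; rewrite /h; ring.
  rewrite !fmeanD fmeanZ fmean_cst// -/y -subr_ge0.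
  by rewrite (_ : _ - _ = y ^+ 2) ?sqr_ge0//; ring.
have be0 : 0 < (b%:R * eps) ^+ 2 by rewrite exprn_gt0// mulr_gt0.
(* Markov's inequality: the indicator of the deviation is at most the squared centered sum divided
   by [(b%:R * eps) ^+ 2]. *)
apply: (@le_trans _ _ (fmean (@iid R T p 'I_b)
    (fun f => ((b%:R * eps) ^+ 2)^-1 * (\sum_i h (f i)) ^+ 2))).
  apply: fmean_le; first exact: iid_fpmf.
  move=> f.
  have -> : (\sum_v W (f v)) / b%:R - y = (\sum_i h (f i)) / b%:R.
    rewrite big_split/= sumr_const card_ord -mulr_natr; field.
    by rewrite gt_eqF.
  case: ltP => [lt_e|_] /=; last by rewrite mulr_ge0 ?sqr_ge0// invr_ge0 ltW.
  rewrite ler_pdivlMl// mulr1 -[leRHS]real_normK ?num_real//.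
  rewrite ler_sqr ?nnegrE ?normr_ge0 ?mulr_ge0 ?ltW//.
  by move: lt_e; rewrite normrM normfV (gtr0_norm b0') ltr_pdivlMr// mulrC.
rewrite fmeanZ fmean_sqr_sum_centered// card_ord.
rewrite ler_pdivlMr ?mulr_gt0 ?exprn_gt0//.
rewrite (_ : _ * _ * _ = fmean p (fun t => h t ^+ 2))//.
by field; rewrite !gt_eqF.
Qed.

(* Markov's inequality for the product of the weights [4] (bad group) and
   [1/4] (good group), which is at least [1] as soon as half of the groups are
   bad and whose mean is at most [(1 / 4 + 15 / 64) ^ g]. *)
Lemma iid_majority_bad (R : realType) (T : finType) (p : T -> R)
    (g : nat) (bad : pred T) :
  is_fpmf p -> fprob p bad <= 16^-1 ->
  fprob (@iid R T p 'I_g)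
    (fun f => (g <= (\sum_u (bad (f u) : nat)).*2)%N) <= 2^-1 ^+ g.
Proof.
move=> pp hb; pose w t : R := 16 ^+ bad t * 4^-1.
have w0 t : 0 <= w t by rewrite mulr_ge0 ?exprn_ge0 ?invr_ge0.
apply: (@le_trans _ _ (fmean (@iid R T p 'I_g) (fun f => \prod_u w (f u)))).
  apply: fmean_le => [|f]; first exact: iid_fpmf.
  case: leqP => /= [le_g|_]; last exact: prodr_ge0.
  rewrite big_split/= -expr_sum prodr_const card_ord.
  rewrite exprVn ler_pdivlMr ?exprn_gt0// mul1r.
  rewrite (_ : 16 = 4 ^+ 2); last by rewrite -natrX.
  by rewrite -exprM mul2n ler_weXn2l// ler1n.
rewrite (fmean_iid_prod p (fun=> w)) prodr_const card_ord; apply: lerXn2r.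
- by rewrite nnegrE; apply: sumr_ge0 => t _; rewrite mulr_ge0 ?(proj1 pp).
- by rewrite nnegrE invr_ge0.
rewrite (@eq_fmean _ _ _ _ (fun t => 4^-1 + 15 / 4 * (bad t)%:R)); last first.
  by move=> t; rewrite /w; case: (bad t); rewrite ?expr1 ?expr0/=; lra.
rewrite fmeanD fmeanZ fmean_cst// -/(fprob p bad); lra.
Qed.

(** Both middle entries of the sorted list lie in the interval, hence so does their average. The
    strict hypothesis also rules out the empty list, so [nth] never returns its default. *)
Lemma median_itv (R : realType) (s : seq R) (lo hi : R) :
  ((count (fun a => ~~ (lo <= a <= hi)%R) s).*2 < size s)%N ->
  lo <= median s <= hi.
Proof.
rewrite /median; set t := sort _ s => hs.
have st : size t = size s by rewrite size_sort.
have sorted_t : sorted <=%R t by apply: sort_sorted; exact: le_total.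
have mono := sorted_leq_nth le_trans (@le_refl _ R) 0 sorted_t.
have {hs} : ((count (fun a => ~~ (lo <= a <= hi)%R) t).*2 < size t)%N.
  by rewrite count_sort st.
rewrite -st => hs; clearbody t; clear st.
set k1 := ((size t).-1)./2; set k2 := (size t)./2.
have k1s : (k1 < size t)%N by rewrite /k1; lia.
have k2s : (k2 < size t)%N by rewrite /k2; lia.
have k12 : t`_k1 <= t`_k2 by apply: mono; rewrite ?inE// /k1 /k2; lia.
(* Otherwise the entries of index 0 to [k1] all lie below [lo], and these are at least half of the
   list. *)
have lo1 : lo <= t`_k1.
  rewrite leNgt; apply/negP => lt_lo.
  suff : (k1.+1 <= count (fun a => ~~ (lo <= a <= hi)%R) t)%N.
    by rewrite /k1; lia.
  rewrite -(cat_take_drop k1.+1 t) count_cat; apply: leq_trans (leq_addr _ _).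
  have : all (fun a => ~~ (lo <= a <= hi)%R) (take k1.+1 t).
    apply/(all_nthP 0) => i; rewrite size_takel// => ik.
    rewrite nth_take// negb_and -ltNge (le_lt_trans _ lt_lo)//.
    by apply: mono; rewrite ?inE ?(leq_ltn_trans _ k1s)// -ltnS.
  by rewrite all_count size_takel// => /eqP ->.
(* Symmetrically, the entries from index [k2] on would all exceed [hi], again at least half of the
   list. *)
have hi2 : t`_k2 <= hi.
  rewrite leNgt; apply/negP => lt_hi.
  suff : (size t - k2 <= count (fun a => ~~ (lo <= a <= hi)%R) t)%N.
    by rewrite /k2; lia.
  rewrite -(cat_take_drop k2 t) count_cat; apply: leq_trans (leq_addl _ _).
  rewrite cat_take_drop.
  have : all (fun a => ~~ (lo <= a <= hi)%R) (drop k2 t).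
    apply/(all_nthP 0) => i; rewrite size_drop => ik.
    rewrite nth_drop negb_and -!ltNge (lt_le_trans lt_hi) ?orbT//.
    by apply: mono; rewrite ?inE ?leq_addr// -ltn_subRL.
  by rewrite all_count size_drop => /eqP ->.
by lra.
Qed.

(** Union bound in which the event [bad i] concerns the coordinate [i] alone, so its probability is
    computed under [p]. *)
Lemma fprob_iid_exists (R : realType) (T I : finType) (p : T -> R)
    (bad : I -> pred T) (a : R) :
  is_fpmf p -> (forall i, fprob p (bad i) <= a) ->
  fprob (@iid R T p I) (fun f => [exists i, bad i (f i)]) <= #|I|%:R * a.
Proof.
move=> pp hb.
apply: (@le_trans _ _ (fmean (@iid R T p I)
    (fun f => \sum_i (bad i (f i))%:R))).
  apply: fmean_le => [|f]; first exact: iid_fpmf.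
  case: existsP => [[i bi]|_] /=; last by apply: sumr_ge0.
  by rewrite (bigD1 i)//= bi lerDl sumr_ge0.
have -> : #|I|%:R * a = \sum_(i : I) a by rewrite sumr_const mulr_natl.
rewrite fmean_sum; apply: ler_sum => i _.
by rewrite (fmean_iid_coord (fun t => (bad i t)%:R))//; exact: hb.
Qed.

Lemma fprob_median_of_means (R : realType) (T : finType) (p W : T -> R)
    (g b : nat) (s eps : R) :
  is_fpmf p -> (0 < b)%N -> 0 < eps -> fmean p (fun t => W t ^+ 2) <= s ->
  16 * s <= b%:R * eps ^+ 2 ->
  fprob (@iid R _ (@iid R T p 'I_b) 'I_g)
    (fun f => ~~ (fmean p W - eps <= median_of_means (fun u v => W (f u v))
                  <= fmean p W + eps)) <= 2^-1 ^+ g.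
Proof.
move=> pp b0 e0 Ws hb; have pb := iid_fpmf 'I_b pp.
pose bad (f : {ffun 'I_b -> T}) :=
  eps < `|(\sum_v W (f v)) / b%:R - fmean p W|.
have hbad : fprob (@iid R T p 'I_b) bad <= 16^-1.
  apply: le_trans (chebyshev_iid_average pp b0 e0 Ws) _.
  by rewrite ler_pdivrMr ?mulr_gt0 ?exprn_gt0 ?ltr0n//; lra.
apply: le_trans _ (iid_majority_bad g pb hbad).
apply: fmean_le => [|f]; first exact: iid_fpmf.
(* Indicators are compared pointwise; when fewer than half of the groups are bad, the median is
   within [eps] and the left one vanishes. *)
rewrite ler_nat; case: (leqP g) => [_|lt_g]; first exact: leq_b1.
rewrite (median_itv _)// size_map size_enum_ord count_map.
rewrite (leq_ltn_trans _ lt_g)// leq_double -sum1_count big_mkcond/=.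
rewrite big_enum/=; apply: leq_sum => u _; rewrite /bad ltNge.
rewrite ler_distl.
by case: (_ && _).
Qed.

Lemma fprob_iid_all (R : realType) (T I : finType) (p : T -> R) (A : pred T) :
  fprob (@iid R T p I) (fun f => [forall i, A (f i)]) = fprob p A ^+ #|I|.
Proof.
rewrite -prodr_const -(fmean_iid_prod p (fun _ t => (A t)%:R)).
apply: eq_fmean => f; case: forallP => [all_A|/forallP/forallPn[i /negPf nA]].
  by rewrite big1// => i _; rewrite all_A.
by rewrite (bigD1 i)//= nA mul0r.
Qed.

(** * Moments of one repetition *)

(** Abstract form of an ACE output: [e i t] stands for the collision of the point [i] with the query
    under the draw [t]. *)
Definition ace_value (R : realType) (T : finType) (N K : nat) (c : 'I_N -> R)
    (e : 'I_N -> pred T) (f : {ffun 'I_K -> T}) : R :=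
  \sum_i c i * [forall k, e i (f k)]%:R.

Lemma fmean_ace_value (R : realType) (T : finType) (N K : nat) (c : 'I_N -> R)
    (p : T -> R) (e : 'I_N -> pred T) :
  fmean (@iid R T p 'I_K) (ace_value c e)
  = \sum_i c i * fprob p (e i) ^+ K.
Proof.
rewrite fmean_sum; apply: eq_bigr => i _.
rewrite fmeanZ; congr (_ * _).
by rewrite -[in RHS](card_ord K) -fprob_iid_all.
Qed.

Lemma fmean_ace_value_sqr (R : realType) (T : finType) (N K : nat)
    (c : 'I_N -> R) (p : T -> R) (e : 'I_N -> pred T) :
  is_fpmf p -> (forall i, -1 <= c i <= 1) ->
  fmean (@iid R T p 'I_K) (fun f => ace_value c e f ^+ 2)
  <= (\sum_i Num.sqrt (fprob p (e i) ^+ K)) ^+ 2.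
Proof.
move=> pp c1.
(* Squaring produces the events that two points both collide with the query under all [K] hash
   functions; the bound is then proved term by term. *)
pose both i j (f : {ffun 'I_K -> T}) := [forall k, e i (f k) && e j (f k)].
rewrite (@eq_fmean _ _ _ _
    (fun f => \sum_i \sum_j c i * c j * (both i j f)%:R)); last first.
  move=> f; rewrite expr2 mulr_suml; apply: eq_bigr => i _.
  rewrite mulr_sumr; apply: eq_bigr => j _; rewrite mulrACA -natrM mulnb.
  congr (_ * _%:R); congr nat_of_bool; apply/andP/forallP.
    by case=> /forallP hi /forallP hj k; rewrite hi hj.
  by move=> h; split; apply/forallP => k; case/andP: (h k).
rewrite fmean_sum expr2 mulr_suml; apply: ler_sum => i _.
rewrite fmean_sum mulr_sumr; apply: ler_sum => j _; rewrite fmeanZ.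
rewrite -/(fprob _ (both i j)) (fprob_iid_all _ p (fun t => e i t && e j t)).
rewrite card_ord; set s := fprob p _.
have fprob_ge0 A : 0 <= fprob p A.
  by apply: sumr_ge0 => t _; rewrite mulr_ge0 ?(proj1 pp).
have si : s <= fprob p (e i).
  by apply: fmean_le => // t; case: (e i t); case: (e j t).
have sj : s <= fprob p (e j).
  by apply: fmean_le => // t; case: (e i t); case: (e j t).
have s0 : 0 <= s ^+ K by rewrite exprn_ge0// fprob_ge0.
apply: (@le_trans _ _ (s ^+ K)).
  rewrite -[leRHS]mul1r ler_wpM2r// (le_trans (ler_norm _))// normrM.
  by rewrite mulr_ile1// ler_norml c1.
(* The joint probability [s] is at most each marginal, so writing [s ^+ K] as the square of its root
   bounds it by the product of the two marginal roots. *)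
rewrite -[leLHS]sqr_sqrtr// expr2.
by apply: ler_pM; rewrite ?sqrtr_ge0// ler_wsqrtr// lerXn2r ?nnegrE ?fprob_ge0.
Qed.

(** * Passage from hash functions to finite laws *)

Lemma measurable_fin_preimage d (Omega : measurableType d) (T : finType)
    (phi : Omega -> T) (G : pred T) :
  (forall t, measurable [set w | phi w = t]) -> measurable [set w | G (phi w)].
Proof.
move=> mphi.
have -> : [set w | G (phi w)]
    = \bigcup_(t in [set t | G t]) [set w | phi w = t].
  by apply/seteqP; split=> [w Gw|w [t Gt /= ->]//]; exists (phi w).
by apply: fin_bigcup_measurable => //; exact: finite_finset.
Qed.

(** The event is the finite disjoint union of the fibres of [phi] over [G]. *)
Lemma probability_fin_preimage d (Omega : measurableType d) (R : realType)
    (P : probability Omega R) (T : finType) (phi : Omega -> T) (G : pred T) :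
  (forall t, measurable [set w | phi w = t]) ->
  P [set w | G (phi w)]
  = (fprob (fun t => fine (P [set w | phi w = t])) G)%:E.
Proof.
move=> mphi.
have -> : [set w | G (phi w)]
    = \bigcup_(t in [set` [seq t <- enum T | G t]]) [set w | phi w = t].
  apply/seteqP; split=> [w Gw|w [t /=]].
    by exists (phi w) => //=; rewrite mem_filter Gw mem_enum.
  by rewrite mem_filter => /andP[Gt _] ->.
rewrite measure_fin_bigcup//; last by move=> t t' _ _ [w [/= -> ->]].
rewrite -fsbig_seq; last by rewrite filter_uniq ?enum_uniq.
rewrite big_filter big_enum_cond/=.
rewrite /fprob /fmean -sumEFin big_mkcond/=; apply: eq_bigr => t _.
by case: (G t); rewrite ?mulr0// mulr1 fineK// fin_num_measure.
Qed.

Lemma measurable_ffun_preimage d (Omega : measurableType d) (I T : finType)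
    (phi : I -> Omega -> T) :
  (forall i t, measurable [set w | phi i w = t]) ->
  forall f : {ffun I -> T}, measurable [set w | [ffun i => phi i w] = f].
Proof.
move=> mphi f.
have -> : [set w | [ffun i => phi i w] = f]
    = \bigcap_(i in [set: I]) [set w | phi i w = f i].
  apply/seteqP; split=> [w <- i _ /=|w h]; first by rewrite ffunE.
  by apply/ffunP => i; rewrite ffunE; exact: h.
by apply: fin_bigcap_measurable => //; exact: finite_finset.
Qed.

Definition collisions (X : Type) (r N : nat) (x : 'I_N -> X) (q : X)
    (l : hash_function X r) : {ffun 'I_N -> bool} :=
  [ffun i => l (x i) == l q].

Lemma measurable_collisions (X : Type) (r N : nat) (x : 'I_N -> X) (q : X) v :
  measurable [set l : hash_function X r | collisions x q l = v].
Proof.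
have mval z j : measurable [set l : hash_function X r | l z = j].
  by apply: sub_gen_smallest; exists z, j.
apply: measurable_ffun_preimage => i t.
(* Equality of two values is not a generating cylinder, but it is decided by the pair of values,
   whose fibres are intersections of two cylinders. *)
pose val2 (l : hash_function X r) := (l (x i), l q).
rewrite (_ : [set _ | _] = [set l | ((val2 l).1 == (val2 l).2) == t]);
  last first.
  by apply/seteqP; split=> l /= h; [rewrite h|exact: (eqP h)].
apply: (@measurable_fin_preimage _ _ _ val2 (fun ab => (ab.1 == ab.2) == t)).
move=> [a b].
rewrite [X in measurable X](_ : _
  = [set l | l (x i) = a] `&` [set l | l q = b]).
  exact: measurableI.
by apply/seteqP; split=> [l [<- <-]//|l [/= <- <-]].
Qed.

Definition collision_law (X : Type) (r : nat) (R : realType)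
    (F : lsh_family X r R) (N : nat) (x : 'I_N -> X) (q : X)
    (v : {ffun 'I_N -> bool}) : R :=
  fine (F [set l | collisions x q l = v]).

Lemma collision_law_fpmf (X : Type) (r : nat) (R : realType)
    (F : lsh_family X r R) (N : nat) (x : 'I_N -> X) (q : X) :
  is_fpmf (collision_law F x q).
Proof.
split=> [v|]; first exact/fine_ge0/measure_ge0.
have := probability_fin_preimage F predT (measurable_collisions x q).
rewrite (_ : [set l | _ (_ l)] = setT); last by apply/seteqP; split.
rewrite probability_setT => -[->].
by apply: eq_bigr => v _; rewrite mulr1.
Qed.

Lemma collision_probE (X : Type) (r : nat) (R : realType)
    (F : lsh_family X r R) (N : nat) (x : 'I_N -> X) (q : X) (i : 'I_N) :
  collision_prob F (x i) q = fprob (collision_law F x q) (fun v => v i).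
Proof.
rewrite /collision_prob.
have := probability_fin_preimage F (fun v : {ffun 'I_N -> bool} => v i)
  (measurable_collisions x q).
rewrite (_ : [set _ | _] = [set l | l (x i) = l q]) => [->//|].
by apply/seteqP; split=> l /=; rewrite ffunE => /eqP.
Qed.

(** The query reads the cell holding the points whose concatenated hash equals its own, that is,
    those colliding with it in all [K] components. *)
Lemma ace_outputE (X : Type) (r K N : nat) (R : realType) (c : 'I_N -> R)
    (x : 'I_N -> X) (q : X) (l : 'I_K -> hash_function X r) :
  ace_output c x q l
  = ace_value c (fun i (v : {ffun 'I_N -> bool}) => v i)
      [ffun k => collisions x q (l k)].
Proof.
apply: eq_bigr => i _; congr (_ * _%:R); congr nat_of_bool.
apply/eqP/forallP => [/ffunP h k|h].
  by have := h k; rewrite !ffunE => ->.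
by apply/ffunP => k; have := h k; rewrite !ffunE => /eqP.
Qed.

(** The nesting (measurement, group, repetition, hash function) matches the iterated [iid], whereas
    [L] is indexed by flat tuples. *)
Definition repetition_collisions d (Omega : measurableType d) (X : Type)
    (r : nat) (R : realType) (P : probability Omega R) (N : nat) (x : 'I_N -> X)
    (q : X) (M g b K : nat)
    (L : 'I_M * 'I_g * 'I_b * 'I_K -> {RV P >-> hash_function X r})
    (w : Omega) :=
  [ffun m => [ffun u => [ffun v => [ffun k =>
    collisions x q (L (m, u, v, k) w)]]]].

Lemma measurable_repetition_collisions d (Omega : measurableType d) (X : Type)
    (r : nat) (R : realType) (P : probability Omega R) (N : nat) (x : 'I_N -> X)
    (q : X) (M g b K : nat)
    (L : 'I_M * 'I_g * 'I_b * 'I_K -> {RV P >-> hash_function X r}) f :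
  measurable [set w | repetition_collisions x q L w = f].
Proof.
do 4! (apply: measurable_ffun_preimage => ? ?).
exact: (measurable_funPTI (L _) (measurable_collisions x q _)).
Qed.

Lemma repetition_collisions_law d (Omega : measurableType d) (X : Type)
    (r : nat) (R : realType) (F : lsh_family X r R) (P : probability Omega R)
    (N : nat) (x : 'I_N -> X) (q : X) (M g b K : nat)
    (L : 'I_M * 'I_g * 'I_b * 'I_K -> {RV P >-> hash_function X r}) f :
  mutually_independent L -> (forall i, has_law (L i) F) ->
  fine (P [set w | repetition_collisions x q L w = f])
  = iid (iid (iid (iid (collision_law F x q)))) f.
Proof.
move=> indepL lawL.
pose A (i : 'I_M * 'I_g * 'I_b * 'I_K) : set (hash_function X r) :=
  [set l | collisions x q l = f i.1.1.1 i.1.1.2 i.1.2 i.2].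
have mA i : measurable (A i) by exact: measurable_collisions.
(* Fixing all bits imposes one condition on each hash function, so the product rule applies with the
   full index set. *)
rewrite (_ : [set w | _]
    = [set w | forall i, i \in [set: _]%SET -> A i (L i w)]);
  last first.
  apply/seteqP; split=> w /=.
    by move=> wf [[[m u] v] k] _; rewrite /A/= -wf !ffunE.
  move=> h; do 4! (apply/ffunP => ?; rewrite !ffunE).
  by apply: (h (_, _, _, _)); rewrite inE.
rewrite indepL//.
rewrite (eq_bigr (fun i => (collision_law F x q
  (f i.1.1.1 i.1.1.2 i.1.2 i.2))%:E)); last first.
  move=> i _; have := lawL i _ (mA i); rewrite /distribution /pushforward => ->.
  by rewrite /collision_law fineK// fin_num_measure//; exact: mA.
rewrite prodEFin /= /iid !pair_bigA/=.
by apply: eq_bigl => i; rewrite inE.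
Qed.

(** * Number and size of the groups *)

Lemma median_of_means_parameters (R : realType) (M : nat) (S eps delta : R) :
  (1 <= M)%N -> 0 < eps -> 0 < delta ->
  exists g b : nat,
    [/\ (0 < g)%N, (0 < b)%N,
      (M * (g * b))%:R <= 34 / ln 2 * repetition_order M S eps delta,
      16 * S ^+ 2 <= b%:R * eps ^+ 2
    & M%:R * 2^-1 ^+ g <= delta].
Proof.
move=> M1 e0 d0; rewrite /repetition_order.
set Q := S ^+ 2 / eps ^+ 2; set T := Num.max 2 (M%:R / delta).
have Q0 : 0 <= Q by rewrite divr_ge0 ?sqr_ge0.
have ln20 : 0 < ln 2 :> R by rewrite ln_gt0// ltr1n.
have T2 : 2 <= T by rewrite le_max lexx.
have T0 : 0 < T by apply: lt_le_trans T2.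
have lnT : ln 2 <= ln T by rewrite ler_ln ?posrE.
have lnT1 : 1 <= ln T / ln 2 by rewrite ler_pdivlMr// mul1r.
(* [g] is just above the binary logarithm of [T], and [b] just above [16 * Q]. Rounding up costs a
   factor 2 for [g], since [T] is at least 2, and turns 16 into 17 for [b]; hence 34. *)
exists (Num.truncn (ln T / ln 2)).+1, (Num.truncn (16 * Q)).+1.
split=> //.
- rewrite natrM natrM.
  have g_le : (Num.truncn (ln T / ln 2)).+1%:R <= 2 * (ln T / ln 2).
    rewrite -natr1.
    have : (Num.truncn (ln T / ln 2))%:R <= ln T / ln 2.
      by rewrite truncn_le (le_trans ler01).
    lra.
  have b_le : (Num.truncn (16 * Q)).+1%:R <= 17 * Num.max 1 Q.
    rewrite -natr1.
    have : (Num.truncn (16 * Q))%:R <= 16 * Q by rewrite truncn_le mulr_ge0.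
    have : 1 <= Num.max 1 Q by rewrite le_max lexx.
    have : Q <= Num.max 1 Q by rewrite le_max lexx orbT.
    lra.
  rewrite (_ : 34 / ln 2 * _
    = M%:R * (2 * (ln T / ln 2) * (17 * Num.max 1 Q))); last by field; lra.
  by rewrite ler_wpM2l// ler_pM.
- have := truncnS_gt (16 * Q); set b := (Num.truncn _).+1%:R => /ltW.
  by rewrite mulrA ler_pdivrMr// exprn_gt0.
- set g := (Num.truncn _).+1.
  (* This says that [T] is below the [g]-th power of 2, which yields the failure bound because
     [M%:R / delta] is at most [T]. *)
  have : ln T / ln 2 < g%:R by exact: truncnS_gt.
  rewrite ltr_pdivrMr// (mulr_natl (ln 2)) -lnXn//.
  rewrite ltr_ln ?posrE ?exprn_gt0// => /ltW.
  have : M%:R / delta <= T by rewrite le_max lexx orbT.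
  move=> h1 /(le_trans h1); rewrite ler_pdivrMr// => h2.
  by rewrite exprVn ler_pdivrMr ?exprn_gt0// mulrC.
Qed.

(** * Simultaneous accuracy for all measurements *)

Theorem theorem4 (R : realType) :
  exists C : R, 0 < C /\
  forall (X : Type) (r : nat) (F : lsh_family X r R)
    (N : nat) (x : 'I_N -> X) (q : X) (K : nat)
    (M : nat) (c : 'I_M -> 'I_N -> R) (eps delta : R),
    (1 <= K)%N ->
    (1 <= M)%N ->
    (forall m i, -1 <= c m i <= 1) ->
    0 < eps ->
    0 < delta < 1 ->
    exists g b : nat,
      [/\ (0 < g)%N, (0 < b)%N,
        (M * (g * b))%:R
          <= C * repetition_order M (l1norm (sqrt_kernel_vec F K x q)) eps delta
        & forall (d : measure_display) (Omega : measurableType d)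
            (P : probability Omega R)
            (L : 'I_M * 'I_g * 'I_b * 'I_K -> {RV P >-> hash_function X r}),
            mutually_independent L ->
            (forall i, has_law (L i) F) ->
            let y m := measurement (c m) (kernel_vec F K x q) in
            let yhat m w := median_of_means (fun u v =>
              ace_output (c m) x q (fun k => L (m, u, v, k) w)) in
            ((1 - delta)%:E
              <= P [set w | forall m : 'I_M,
                     (y m - eps <= yhat m w <= y m + eps)%R])%E].
Proof.
exists (34 / ln 2); split; first by rewrite divr_gt0// ln_gt0// ltr1n.
move=> X r F N x q K M c eps delta _ M1 c1 e0 /andP[d0 _].
set S := l1norm _.
have [g [b [g0 b0 cost b_large g_large]]] :=
  median_of_means_parameters S M1 e0 d0.
exists g, b; split=> // d Omega P L indepL lawL.
pose y m := measurement (c m) (kernel_vec F K x q).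
pose yhat m w := median_of_means (fun u v =>
  ace_output (c m) x q (fun k => L (m, u, v, k) w)).
change ((1 - delta)%:E <= P [set w | forall m : 'I_M,
  (y m - eps <= yhat m w <= y m + eps)%R])%E.
pose p := collision_law F x q; have pp : is_fpmf p by exact: collision_law_fpmf.
pose e (i : 'I_N) (v : {ffun 'I_N -> bool}) := v i.
have yE m : y m = fmean (@iid R _ p 'I_K) (ace_value (c m) e).
  rewrite fmean_ace_value; apply: eq_bigr => i _.
  by rewrite mxE collision_probE.
have SE : S = \sum_i Num.sqrt (fprob p (e i) ^+ K).
  apply: eq_bigr => i _.
  by rewrite mxE ger0_norm ?sqrtr_ge0// collision_probE.
(* Finite outcome space of all draws that serve a single measurement. *)
pose U := {ffun 'I_g -> {ffun 'I_b -> {ffun 'I_K -> {ffun 'I_N -> bool}}}}.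
pose good m (f : U) :=
  y m - eps <= median_of_means (fun u v => ace_value (c m) e (f u v))
  <= y m + eps.
pose all_good (f : {ffun 'I_M -> _}) := [forall m, good m (f m)].
(* The success event depends on the collision bits only, so its probability can be computed under
   the finite product law. *)
have -> : [set w | forall m, (y m - eps <= yhat m w <= y m + eps)%R]
    = [set w | all_good (repetition_collisions x q L w)].
  have yhatE m w : yhat m w = median_of_means
      (fun u v => ace_value (c m) e (repetition_collisions x q L w m u v)).
    congr median_of_means; apply/funext => u; apply/funext => v.
    by rewrite ace_outputE !ffunE.
  apply/seteqP; split=> w /=.
    by move=> h; apply/forallP => m; rewrite /good -yhatE.
  by move=> /forallP h m; rewrite yhatE; exact: h.
rewrite (probability_fin_preimage P all_good
  (measurable_repetition_collisions x q L)) lee_fin.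
pose law1 : U -> R := iid (iid (iid p)).
have law1_pmf : is_fpmf law1 by do 3! apply: iid_fpmf.
have lawM_pmf : is_fpmf (@iid R _ law1 'I_M) by exact: iid_fpmf.
rewrite (_ : fprob _ _ = fprob (iid law1) all_good); last first.
  apply: eq_bigr => f _.
  by rewrite (repetition_collisions_law x q f indepL lawL).
rewrite (_ : fprob _ _ = 1 - fprob (@iid R _ law1 'I_M)
    (fun f => [exists m, ~~ good m (f m)])); last first.
  by rewrite (fprob_compl all_good lawM_pmf).
(* It remains to bound the failure probability by [M] times that of a single measurement, each at
   most [2^-1 ^+ g]. *)
rewrite lerB// (le_trans _ g_large)// -[M in leRHS]card_ord.
apply: (fprob_iid_exists (bad := fun m f => ~~ good m f)) => // m.
rewrite /good yE.
apply: fprob_median_of_means b_large => //; first exact: iid_fpmf.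
by rewrite SE; exact: fmean_ace_value_sqr.
Qed.
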